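(* Let $\phi,\phi',\phi^\vee,\phi'^\vee:PS\to R$ be functions such that ${}^\flat\phi=\phi+\hbar\phi'$ and ${}^\flat\phi^\vee=\phi^\vee+\hbar\phi'^\vee$, as functions $PS\to R[\hbar]/(\hbar^2)$, are multiplicative and satisfy ${}^\flat\phi=\zeta*{}^\flat\phi^\vee$. Then $$G_{\frac12,1}(X)=P^\vee(w)\,G^\vee_{\frac12,1}(w),\qquad X=\frac w{G^\vee_{0,1}(w)},\qquad P^\vee(w)=\frac{\mathrm d\ln w}{\mathrm d\ln X}.$$ Equivalently, $G_{\frac12,1}(X)\frac{\mathrm dX}X=G^\vee_{\frac12,1}(w)\frac{\mathrm dw}w$.
   Context: $R$ is a commutative $\mathbb Q$-algebra. $P(d)$ is the lattice of set partitions of $[d]$ ($\vee$ = join, $\mathbf 1_d=\{[d]\}$); $\mathbf 0_\alpha$ is the partition into supports of cycles of $\alpha\in S(d)$. $PS(d)=\{(\mathcal A,\alpha)\in P(d)\times S(d):\mathbf 0_\alpha\le\mathcal A\}$, $PS=\bigcup_{d\ge1}PS(d)$. $|\mathcal A|=d-\#\mathcal A$, $|\alpha|=d-\#\mathbf 0_\alpha$, $|(\mathcal A,\alpha)|=2|\mathcal A|-|\alpha|$. $(f_1*f_2)(\mathcal C,\gamma)=\sum f_1(\mathcal A,\alpha)f_2(\mathcal B,\beta)$ over pairs in $PS(d)$ with $\mathcal A\vee\mathcal B=\mathcal C$, $\alpha\circ\beta=\gamma$ and $|(\mathcal A,\alpha)|+|(\mathcal B,\beta)|=|(\mathcal C,\gamma)|$.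 $\zeta(\mathcal A,\alpha)=1$ if $\mathcal A=\mathbf 0_\alpha$, else $0$. A function $f$ on $PS$ is multiplicative if $f(\mathbf 1_d,\sigma)$ depends only on the conjugacy class of $\sigma$ and $f(\mathcal A,\alpha)=\prod_{A\in\mathcal A}f(\mathbf 1_{\#A},\alpha_{|A})$, $\alpha_{|A}$ being the restriction transported to $[\#A]$ by any bijection. The one-point functions are $$G^\vee_{0,1}(w)=1+\sum_{k\ge1}\phi^\vee(\mathbf 1_k,(1\,2\cdots k))w^k,\quad G_{\frac12,1}(X)=\sum_{k\ge1}\phi'(\mathbf 1_k,(1\,2\cdots k))X^k,\quad G^\vee_{\frac12,1}(w)=\sum_{k\ge1}\phi'^\vee(\mathbf 1_k,(1\,2\cdots k))w^k.$$ *)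

(* Defs.v *)
From mathcomp Require Import all_boot all_order all_algebra all_fingroup.

Set Implicit Arguments.
Unset Strict Implicit.
Unset Printing Implicit Defensive.

Import GRing.Theory.
Local Open Scope ring_scope.

Section SetPartitions.
Variable T : finType.
Implicit Types (P Q C : {set {set T}}) (s : {perm T}).

Definition refines P Q : bool :=
  [forall A in P, exists B in Q, A \subset B].

Definition same_block P : rel T := fun x y => y \in pblock P x.

(* The join in the lattice of set partitions; see join_lub. *)
Definition join P Q : {set {set T}} :=
  equivalence_partition
    (connect (fun x y => same_block P x y || same_block Q x y)) [set: T].

(* The partition with a single block; removing set0 only matters when T is
   empty, the empty set having set0 as its unique partition. *)
Definition one_block : {set {set T}} := [set [set: T]] :\ set0.

Lemma partition_one_block : partition one_block [set: T].
Proof.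
apply/and3P; split; last by rewrite !inE eqxx.
- apply/eqP/setP=> x; rewrite inE; apply/bigcupP.
  exists [set: T]; last by rewrite inE.
  by rewrite !inE eqxx andbT; apply/set0Pn; exists x; rewrite inE.
- apply/trivIsetP=> A B; rewrite !inE => /andP[_ /eqP->] /andP[_ /eqP->].
  by rewrite eqxx.
Qed.

(* [porbits s] is the set of supports of the cycles of s (fixed points
   included). *)
Lemma refines_porbits_one_block s : refines (porbits s) one_block.
Proof.
apply/forall_inP=> A /imsetP[x _ ->]; apply/exists_inP.
exists [set: T]; last exact: subsetT.
by rewrite !inE eqxx andbT; apply/set0Pn; exists x; rewrite inE.
Qed.

Lemma same_block_equiv P : partition P [set: T] ->
  equivalence_rel (same_block P).
Proof.
case/and3P=> /eqP cP tP _ x y z; rewrite /same_block.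
have xP u : u \in cover P by rewrite cP inE.
split; first by rewrite mem_pblock.
by move=> Hy; rewrite (same_pblock tP Hy).
Qed.

Lemma refines_same_block P Q : partition P [set: T] -> partition Q [set: T] ->
  reflect (forall x y, same_block P x y -> same_block Q x y) (refines P Q).
Proof.
move=> /and3P[/eqP cP tP P0] /and3P[/eqP cQ tQ _].
apply: (iffP forall_inP) => [rPQ x y xy | sPQ A AP].
  have Px : pblock P x \in P by rewrite pblock_mem // cP inE.
  have /exists_inP[B BQ /subsetP sAB] := rPQ _ Px.
  have xB : x \in B by apply: sAB; rewrite mem_pblock cP inE.
  by rewrite /same_block (def_pblock tQ BQ xB); apply: sAB.
have /set0Pn[x xA] : A != set0 by apply: contraNneq P0 => <-.
apply/exists_inP; exists (pblock Q x).
  by rewrite pblock_mem // cQ inE.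
apply/subsetP=> y yA; apply: sPQ.
by rewrite /same_block (def_pblock tP AP xA).
Qed.

Lemma join_lub P Q : partition P [set: T] -> partition Q [set: T] ->
  [/\ partition (join P Q) [set: T], refines P (join P Q),
      refines Q (join P Q) &
      forall C, partition C [set: T] -> refines P C -> refines Q C ->
        refines (join P Q) C].
Proof.
move=> pP pQ; set e := fun x y => same_block P x y || same_block Q x y.
have symB D : partition D [set: T] -> symmetric (same_block D).
  move=> /same_block_equiv eD x y; have [Dx trD] := eD x y x.
  apply/idP/idP => [xy|yx]; first by rewrite -trD.
  have [_ trD'] := eD y x y.
  by rewrite -(trD' yx); case: (eD y y y).
have se : symmetric e.
  by move=> x y; rewrite /e (symB _ pP) (symB _ pQ).
have ce := sym_connect_sym se.
have eqe : {in [set: T] & &, equivalence_rel (connect e)}.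
  move=> x y z _ _ _; split; first exact: connect0.
  by move=> xy; rewrite (same_connect ce xy).
have pJ : partition (join P Q) [set: T] by exact: equivalence_partitionP.
have sJ x y : same_block (join P Q) x y = connect e x y.
  by rewrite /same_block (pblock_equivalence_partition eqe) // inE.
split=> // [||C pC rP rQ].
- by apply/refines_same_block => // x y xy; rewrite sJ connect1 // /e xy.
- by apply/refines_same_block => // x y xy; rewrite sJ connect1 // /e xy orbT.
- apply/refines_same_block => // x y; rewrite sJ => /connectP[p + ->].
  have eC := same_block_equiv pC.
  elim: p x => [|z p IH] x /=; first by move=> _; case: (eC x x x).
  case/andP=> xz /IH zl; have [_ tr] := eC x z (last z p); rewrite tr //.
  case/orP: xz; [exact: (refines_same_block pP pC rP)
                |exact: (refines_same_block pQ pC rQ)].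
Qed.

End SetPartitions.

Definition is_partitioned_perm d (x : {set {set 'I_d}} * 'S_d) : bool :=
  partition x.1 [set: 'I_d] && refines (porbits x.2) x.1.

(* [d] is represented by 'I_d = {0, ..., d - 1}.  The type is defined for all
   d, but only d > 0 belongs to PS: every condition on functions on PS below
   is restricted to d > 0. *)
Definition PS d := {x : {set {set 'I_d}} * 'S_d | is_partitioned_perm x}.

Definition ps_part d (x : PS d) : {set {set 'I_d}} := (val x).1.
Definition ps_perm d (x : PS d) : 'S_d := (val x).2.

Lemma one_block_PS d (s : 'S_d) : is_partitioned_perm (one_block 'I_d, s).
Proof.
by rewrite /is_partitioned_perm partition_one_block refines_porbits_one_block.
Qed.

Definition ps_one d (s : 'S_d) : PS d := Sub (one_block 'I_d, s) (one_block_PS s).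

(* The natural-number subtractions do not truncate: #P <= d for a partition P
   of [d], and #P <= #0_s as soon as 0_s refines P, so that
   |s| <= |P| <= 2 |P|. *)
Definition part_len d (P : {set {set 'I_d}}) : nat := (d - #|P|)%N.
Definition perm_len d (s : 'S_d) : nat := (d - #|porbits s|)%N.
Definition ps_len d (x : PS d) : nat :=
  (2 * part_len (ps_part x) - perm_len (ps_perm x))%N.

Definition PSfun (S : Type) := forall d, PS d -> S.

(* Permutations act on the right in MathComp: (b * a) i = a (b i), hence the
   composite a \o b is b * a. *)
Definition ps_conv (S : comNzRingType) (f g : PSfun S) : PSfun S :=
  fun d z =>
    \sum_(x : PS d) \sum_(y : PS d |
        [&& join (ps_part x) (ps_part y) == ps_part z,
            (ps_perm y * ps_perm x)%g == ps_perm z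
          & (ps_len x + ps_len y)%N == ps_len z]) f d x * g d y.

Definition ps_zeta (S : comNzRingType) : PSfun S :=
  fun d x => (ps_part x == porbits (ps_perm x))%:R.

(* The restriction of a permutation s to an s-stable set A, transported to
   'I_#|A| along the enumeration of A. *)
Definition restr_fun d (A : {set 'I_d}) (s : 'S_d) (i : 'I_#|A|) : 'I_#|A| :=
  enum_rank_in (enum_valP i) (restr_perm A s (enum_val i)).
Arguments restr_fun {d} A s i.

Lemma restr_fun_inj d (A : {set 'I_d}) (s : 'S_d) : injective (restr_fun A s).
Proof.
have stA x : x \in A -> restr_perm A s x \in A.
  by rewrite (perm_closed _ (restr_perm_on A s)).
move=> i j; rewrite /restr_fun => /(congr1 enum_val).
by rewrite !enum_rankK_in ?stA ?enum_valP // => /perm_inj /enum_val_inj.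
Qed.

Definition ps_restr d (A : {set 'I_d}) (s : 'S_d) : 'S_#|A| :=
  perm (@restr_fun_inj d A s).

(* Since f (1_d, s) depends only on the conjugacy class of s, the choice of
   the bijection A -> 'I_#|A| made in ps_restr is irrelevant. *)
Definition ps_multiplicative (S : comNzRingType) (f : PSfun S) : Prop :=
  (forall d (s t : 'S_d), (0 < d)%N -> t \in (s ^: [set: 'S_d])%g ->
     f d (ps_one s) = f d (ps_one t)) /\
  (forall d (x : PS d), (0 < d)%N ->
     f d x = \prod_(A in ps_part x) f #|A| (ps_one (ps_restr A (ps_perm x)))).

(* The cycle (1 2 ... k). *)
Definition full_cycle k : 'S_k := perm (@ordS_inj k).

Definition dual (R : comNzRingType) := {poly %/ ('X^2 : {poly R})}.

Definition hbar (R : comNzRingType) : dual R := in_qpoly 'X^2 'X.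

Definition flat (R : comNzRingType) (f f' : PSfun R) : PSfun (dual R) :=
  fun d x => (f d x)%:A + f' d x *: hbar R.

Definition fps (R : Type) := nat -> R.

Section FormalPowerSeries.
Variable R : comNzRingType.
Implicit Types f g : fps R.

Definition fps_one : fps R := fun n => (n == 0%N)%:R.
Definition fps_var : fps R := fun n => (n == 1%N)%:R.
Definition fps_sub f g : fps R := fun n => f n - g n.
Definition fps_mul f g : fps R := fun n => \sum_(i < n.+1) f i * g (n - i)%N.
Definition fps_exp f k : fps R := iter k (fps_mul f) fps_one.
Definition fps_deriv f : fps R := fun n => f n.+1 *+ n.+1.
(* Division by the variable, for series without constant coefficient. *)
Definition fps_shift f : fps R := fun n => f n.+1.

(* g(f(w)) for f without constant coefficient: f^k has no coefficient of
   degree < k, hence the sum may be truncated at k = n. *)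
Definition fps_comp g f : fps R :=
  fun n => \sum_(k < n.+1) g k * fps_exp f k n.

(* The inverse of a series with constant coefficient 1, as the geometric
   series of powers of 1 - f, truncated as above; see fps_mulV. *)
Definition fps_inv f : fps R :=
  fun n => \sum_(k < n.+1) fps_exp (fps_sub fps_one f) k n.

Lemma fps_exp_eq0 f k n : f 0%N = 0 -> (n < k)%N -> fps_exp f k n = 0.
Proof.
move=> f0; elim: k n => // k IH n ltnk; rewrite /fps_exp iterS /fps_mul.
rewrite big1 // => -[[|i] lti] _ /=; first by rewrite f0 mul0r.
by rewrite -/(fps_exp f k) IH ?mulr0 //; apply: leq_trans (ltnk : n <= k)%N;
  rewrite ltn_subrL /=; case: n lti {ltnk}.
Qed.

Lemma fps_mulV f : f 0%N = 1 -> fps_mul f (fps_inv f) =1 fps_one.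
Proof.
move=> f0 n; set u := fps_sub fps_one f.
have u0 : u 0%N = 0 by rewrite /u /fps_sub /fps_one f0 subrr.
have fE i : f i = fps_one i - u i by rewrite /u /fps_sub opprB addrC subrK.
have invE m : (m <= n)%N -> fps_inv f m = \sum_(k < n.+1) fps_exp u k m.
  move=> lemn; rewrite /fps_inv -/u (big_ord_widen n.+1 (fun k => fps_exp u k m)) //.
  rewrite big_mkcond; apply: eq_bigr => k _; case: ltnP => // ltmk.
  by rewrite fps_exp_eq0.
rewrite /fps_mul; under eq_bigr => i _ do rewrite fE mulrBl.
rewrite sumrB [X in X - _]big_ord_recl /= subn0 mul1r [X in _ + X - _]big1 ?addr0;
  last by move=> i _; rewrite /fps_one /= mul0r.
under [X in _ - X]eq_bigr => i _ do rewrite invE ?leq_subr // mulr_sumr.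
rewrite exchange_big invE // /=.
under [X in _ - X]eq_bigr => k _ do rewrite -[\sum_(i < _) _]/(fps_exp u k.+1 n).
rewrite big_ord_recl [X in _ - X]big_ord_recr /=.
by rewrite -[fps_mul u (fps_exp u n)]/(fps_exp u n.+1) fps_exp_eq0 // addr0 addrK.
Qed.

(* w (d ln f / dw) = f'(w) / (f(w) / w), for f without constant coefficient and
   with linear coefficient 1.  Equivalently, the logarithmic differential form
   df / f is fps_dlog f * (dw / w), and dw / w is a basis of these forms. *)
Definition fps_dlog f : fps R :=
  fps_mul (fps_deriv f) (fps_inv (fps_shift f)).

(* c + \sum_(k >= 1) phi (1_k, (1 2 ... k)) w^k *)
Definition one_point (c : R) (phi : PSfun R) : fps R :=
  fun k => if k == 0%N then c else phi k (ps_one (full_cycle k)).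

End FormalPowerSeries.

(* Main.v *)
Require Import Defs.
From mathcomp Require Import all_boot all_order all_algebra all_fingroup.
From mathcomp Require Import zify.
From Stdlib Require Import FunctionalExtensionality Ring.

(** Why the theorem holds.

    Evaluate the convolution of zeta with a multiplicative function g at
    (1_k, c), where c = (1 2 ... k).  Zeta forces the first factor to be
    (0_a, a).  If b is the permutation of the second factor, its partition is
    coarser than 0_b, while the length condition asks for the least value that
    |a| + |b| >= |c| permits; so the partition is 0_b and |a| + |b| = |c|.  The
    convolution is therefore a sum over the geodesics from the identity to c in
    the Cayley graph of the symmetric group, that is, over noncrossing
    permutations b, weighted by the product over the cycles of b of the values
    g_s of g at the cycles of length s ([ps_conv_zeta_full_cycle]).

    Such sums obey a convolution recursion ([nc_numberS]).  Consider c on an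
    interval whose last point is n, and let p be the point that b sends to n.
    If p = n, the fixed point n can be dropped from b and c.  Otherwise
    multiplying both b and c by the transposition (p n) removes n from its
    cycle and cuts c into two cycles on consecutive intervals; the rest of b is
    then a pair of geodesics, one below each piece, and the cycle of p has lost
    one point.  Let V_j be the generating series of the weighted sums in which
    the cycle of the last point is counted with g_(s + j) instead of g_s; its
    constant term is g_j, with g_0 = 1.  The recursion says that
    V_j = g_j + w V_(j+1) V_0.

    The coefficients here are dual numbers.  Write V_j = v_j + h v'_j, where h
    is the infinitesimal, and similarly for g.  Substituting X = w / g(w) for
    the variable, the order 0 equations become a_j = g_j + X a_(j+1) a_0.  They
    have a unique solution, and the tails sum_n g_(n+j) w^n of g solve them,
    because w = X g(w) ([comp_leading]).  The order 1 equations are linear: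
    b_j = g'_j + w b_(j+1) + X b_0 a_(j+1).  Iterated from j = 0, they give
    b_0 = g' + X b_0 (dg/dw) ([comp_correction]), and 1 - X (dg/dw) is the
    logarithmic derivative of X ([fps_dlog_div_var]).  Since b_0 is the series
    of phi' at X, and g' that of its dual, this is the claim. *)

Set Implicit Arguments.
Unset Strict Implicit.
Unset Printing Implicit Defensive.

Import GRing.Theory.

(** * Geodesics in the Cayley graph of the symmetric group *)

Section PermLength.
Variable T : finType.
Implicit Types (s t c b : {perm T}) (x y : T) (A B : {set T}).
Local Open Scope group_scope.

(** The distance from the identity to s in the Cayley graph generated by all
    transpositions. *)
Definition plen s : nat := (#|T| - #|porbits s|)%N.

Lemma porbits_leq s : #|porbits s| <= #|T|.
Proof. by exact: leq_trans (leq_imset_card _ _) (max_card _). Qed.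

Lemma porbit_sub s A x : (forall y, y \in A -> s y \in A) -> x \in A ->
  porbit s x \subset A.
Proof.
move=> stA xA; apply/subsetP => y /porbitP[i ->].
by elim: i => [|i IH]; rewrite ?expg0 ?perm1 // expgSr permM stA.
Qed.

Lemma porbit_fix s x : s x = x -> porbit s x = [set x].
Proof.
move=> sx; apply/eqP; rewrite eqEsubset sub1set porbit_id andbT.
by apply: porbit_sub; rewrite ?set11 // => y /set1P->; rewrite sx set11.
Qed.

Lemma eq_in_porbit s t A x : (forall y, y \in A -> s y = t y) ->
  (forall y, y \in A -> s y \in A) -> x \in A -> porbit s x = porbit t x.
Proof.
move=> est stA xA; apply/setP => y.
have E i : ((s ^+ i) x \in A) && ((s ^+ i) x == (t ^+ i) x).
  elim: i => [|i /andP[IA /eqP E]]; first by rewrite !expg0 !perm1 xA eqxx.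
  by rewrite !expgSr !permM stA // -E est ?eqxx.
by apply/porbitP/porbitP => -[i ->]; exists i; have /andP[_ /eqP->] := E i.
Qed.

Lemma perm_mem_porbit s x y : (s y \in porbit s x) = (y \in porbit s x).
Proof.
rewrite -!eq_porbit_mem; congr (_ == _); have := porbit_perm s 1 y.
by rewrite expg1.
Qed.

Lemma plen1 : plen 1 = 0.
Proof.
rewrite /plen /porbits card_imset ?subnn // => x y.
by rewrite !porbit_fix ?perm1 //; exact: set1_inj.
Qed.

Lemma plenV s : plen s^-1 = plen s.
Proof. by rewrite /plen porbitsV. Qed.

Lemma plen_tpermM x y s : x != y ->
  plen (tperm x y * s) = if x \in porbit s y then (plen s).-1 else (plen s).+1.
Proof.
move=> nxy; have := porbits_mul_tperm s x y; rewrite /= nxy.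
have := porbits_leq s; have := porbits_leq (tperm x y * s).
rewrite /plen; case: ifP => _ /=; lia.
Qed.

Lemma plen_tpermM_fix x y s : x != y -> s y = y ->
  plen (tperm x y * s) = (plen s).+1.
Proof.
by move=> nxy sy; rewrite plen_tpermM // porbit_fix // inE (negPf nxy).
Qed.

Lemma plenM_tperm x y s : plen (s * tperm x y) = plen (tperm x y * s^-1).
Proof. by rewrite -plenV invMg tpermV. Qed.

Lemma plenM_tperm_fix x y s : x != y -> s y = y ->
  plen (s * tperm x y) = (plen s).+1.
Proof.
move=> nxy sy; rewrite plenM_tperm plen_tpermM_fix ?plenV //.
by rewrite -{1}sy permK.
Qed.

(** Multiplying s by (x  s x) makes s x a fixed point, so every permutation is
    built from the identity by transpositions (x y) with y fixed so far.  Each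
    such step adds exactly 1 to the length ([plen_tpermM_fix]), and this makes
    the induction suited to statements about lengths. *)
Lemma perm_tperm_ind A (P : {perm T} -> Prop) : P 1 ->
  (forall x y s, x \in A -> y \in A -> x != y -> perm_on A s -> s y = y ->
     P s -> P (tperm x y * s)) ->
  forall s, perm_on A s -> P s.
Proof.
move=> P1 Pt s; elim: {s}_.+1 {-2}s (ltnSn #|[set x | s x != x]|) => // n IH s.
rewrite ltnS => len sA.
have [/forallP s1|/forallPn[x sx]] := boolP [forall x, s x == x].
  by have -> // : s = 1; apply/permP => x; rewrite perm1 (eqP (s1 x)).
set y := s x; set s' := tperm x y * s.
have xA : x \in A by apply: (subsetP sA); rewrite inE.
have yA : y \in A by rewrite perm_closed.
have s'y : s' y = y by rewrite permM tpermR.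
have s'A : perm_on A s'.
  apply: perm_onM => //; apply: subset_trans (tperm_on x y) _.
  by apply/subsetP => z; rewrite !inE => /orP[]/eqP->.
have -> : s = tperm x y * s' by rewrite mulgA tperm2 mul1g.
apply: Pt => //; first by rewrite eq_sym.
apply: IH => //; apply: leq_trans len; apply: proper_card; apply/properP.
split; last first.
  exists y; rewrite !inE ?s'y ?eqxx //; apply: contraNneq sx.
  by move/perm_inj=> E; rewrite -/y E.
apply/subsetP => z; rewrite !inE permM.
case: tpermP => [->//|->//|_ _]; last by [].
by rewrite -/y eqxx.
Qed.

Lemma perm_onT s : perm_on [set: T] s.
Proof. by apply/subsetP => x _; rewrite inE. Qed.

Lemma plenM s t : (plen (s * t) <= plen s + plen t)%N.
Proof.
move: s (perm_onT s); apply: perm_tperm_ind => [|x y s _ _ nxy _ sy IH].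
  by rewrite mul1g plen1.
rewrite plen_tpermM_fix // -mulgA plen_tpermM // addSn.
by case: ifP => _; rewrite ?ltnS //; apply: leq_trans (leq_pred _) (leqW IH).
Qed.

Lemma perm_on_notin A B s x :
  perm_on A s -> [disjoint A & B] -> x \in B -> s x = x.
Proof.
move=> sA dAB xB; apply: out_perm sA _.
by move: dAB; rewrite disjoint_sym => /disjointFr->.
Qed.

Lemma plenM_disjoint A B s t : [disjoint A & B] -> perm_on A s -> perm_on B t ->
  plen (s * t) = (plen s + plen t)%N.
Proof.
move=> dAB + tB; move: s.
apply: perm_tperm_ind => [|x y s xA yA nxy sA sy IH].
  by rewrite mul1g plen1.
rewrite plen_tpermM_fix // -mulgA plen_tpermM_fix ?IH //.
by rewrite permM sy (perm_on_notin tB _ yA) // disjoint_sym.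
Qed.

(** b lies on a geodesic from the identity to c.  When c is a long cycle these
    b are the noncrossing permutations. *)
Definition geodesic c b := (plen b + plen (b^-1 * c) == plen c)%N.

Lemma geodesic1 b : geodesic 1 b = (b == 1).
Proof.
apply/idP/eqP => [|->]; last by rewrite /geodesic mulg1 plenV plen1.
rewrite /geodesic mulg1 plenV plen1 addn_eq0 andbb => b0.
move: b (perm_onT b) b0; apply: perm_tperm_ind => // x y s _ _ nxy _ sy _.
by rewrite plen_tpermM_fix.
Qed.

(** When lengths add up, multiplying b successively by the transpositions of a
    geodesic only ever merges cycles: a step that split one would shorten the
    product. *)
Lemma porbit_subM a b x : plen (a * b) = (plen a + plen b)%N ->
  porbit b x \subset porbit (a * b) x.
Proof.
move: a (perm_onT a); apply: perm_tperm_ind => [_|y z a _ _ nyz _ az IH].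
  by rewrite mul1g.
rewrite (plen_tpermM_fix nyz az) -mulgA => E; set c := a * b in IH E *.
have lec : (plen c <= plen a + plen b)%N by exact: plenM.
have Ec : plen c = (plen a + plen b)%N.
  by move: E; rewrite plen_tpermM //; case: ifP => _; lia.
have yz : porbit (tperm y z * c) y = porbit (tperm y z * c) z.
  apply/eqP; rewrite eq_porbit_mem; have := plen_tpermM (tperm y z * c) nyz.
  by rewrite tpermKg E Ec; case: ifP => // _; lia.
apply: subset_trans (IH Ec) _; apply: porbit_sub (porbit_id _ _) => u.
have -> : c u = (tperm y z * c) (tperm y z u) by rewrite permM tpermK.
by rewrite perm_mem_porbit; case: tpermP => // ->; rewrite -!eq_porbit_mem yz.
Qed.

Lemma geodesic_porbit c b x : geodesic c b -> porbit b x \subset porbit c x.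
Proof.
move=> /eqP E; rewrite -(porbitV b) -(porbitV c).
have -> : c^-1 = (b^-1 * c)^-1 * b^-1 by rewrite -invMg mulKVg.
by apply: porbit_subM; rewrite -invMg mulKVg !plenV addnC E.
Qed.

Lemma geodesic_fix c b x : geodesic c b -> c x = x -> b x = x.
Proof.
move=> /(geodesic_porbit x) + cx; rewrite (porbit_fix cx) => /subsetP/(_ (b x)).
by rewrite perm_mem_porbit porbit_id => /(_ isT)/set1P.
Qed.

Lemma geodesic_on A c b : perm_on A c -> geodesic c b -> perm_on A b.
Proof.
move=> cA gcb; apply/subsetP => x; rewrite inE; apply: contraR => xA.
by rewrite (geodesic_fix gcb) // (out_perm cA).
Qed.

(** If c fixes y, the factor (x y) inserts y into the cycle of x, and the
    geodesics below the longer cycle that fix y are those below c.  Both are 1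
    and nothing is inserted when x = y. *)
Lemma geodesicM_tperm c b x y : c y = y ->
  geodesic (c * tperm x y) b && (b y == y) = geodesic c b.
Proof.
move=> cy; have [-> | nxy] := eqVneq x y.
  rewrite tperm1 mulg1; case g: (geodesic c b) => //=.
  by rewrite (geodesic_fix g cy) eqxx.
have E : b y = y -> geodesic (c * tperm x y) b = geodesic c b.
  move=> bY; rewrite /geodesic mulgA !plenM_tperm_fix ?addnS ?eqSS //.
  by rewrite permM -{1}bY permK.
apply/andP/idP => [[+ /eqP bY]|gcb]; first by rewrite E.
by have bY := geodesic_fix gcb cy; rewrite E // bY eqxx.
Qed.

Lemma geodesic_tpermM c b x y : x != y -> b y = y ->
  plen (tperm x y * c) = (plen c).+1 ->
  geodesic (tperm x y * c) (tperm x y * b) = geodesic c b.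
Proof.
move=> nxy bY lc; rewrite /geodesic lc plen_tpermM_fix // invMg tpermV -mulgA.
by rewrite tpermKg addSn eqSS.
Qed.

(** Lengths add over disjoint supports, and the triangle inequality holds on
    each support; equality in the sum forces equality in both. *)
Lemma geodesicM_disjoint A B c1 c2 b1 b2 : [disjoint A & B] ->
  perm_on A c1 -> perm_on B c2 -> perm_on A b1 -> perm_on B b2 ->
  geodesic (c1 * c2) (b1 * b2) = geodesic c1 b1 && geodesic c2 b2.
Proof.
move=> dAB c1A c2B b1A b2B; rewrite /geodesic.
have -> : (b1 * b2)^-1 * (c1 * c2) = b1^-1 * c1 * (b2^-1 * c2).
  have cb s : perm_on A s -> s * b2^-1 = b2^-1 * s.
    by move=> sA; apply: perm_onC dAB; rewrite ?perm_onV.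
  rewrite invMg -(cb b1^-1) ?perm_onV // -(mulgA b1^-1) (mulgA b2^-1).
  by rewrite -(cb c1) // !mulgA.
have b1cA := perm_onM (perm_onV b1A) c1A.
have b2cB := perm_onM (perm_onV b2B) c2B.
rewrite !(plenM_disjoint dAB b1A b2B, plenM_disjoint dAB c1A c2B,
          plenM_disjoint dAB b1cA b2cB).
have := plenM b1 (b1^-1 * c1); have := plenM b2 (b2^-1 * c2); rewrite !mulKVg.
move: (plen b1) (plen b2) (plen c1) (plen c2).
move: (plen (b1^-1 * c1)) (plen (b2^-1 * c2)).
by move=> *; lia.
Qed.

Lemma astabs_perm A s : (forall x, x \in A -> s x \in A) -> s \in 'N(A | 'P).
Proof. by move=> stA; rewrite !inE; apply/subsetP => x /stA; rewrite inE. Qed.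

Lemma restr_permM_disjoint A B s t : [disjoint A & B] ->
  perm_on A s -> perm_on B t -> restr_perm A (s * t) = s.
Proof.
move=> dAB sA tB; have stA x : x \in A -> (s * t) x = s x.
  move=> xA; rewrite permM (perm_on_notin tB (_ : [disjoint B & A])) //.
    by rewrite disjoint_sym.
  by rewrite perm_closed.
have stN : s * t \in 'N(A | 'P).
  by apply: astabs_perm => x xA; rewrite stA // perm_closed.
apply/permP => x; have [xA|xA] := boolP (x \in A).
  by rewrite restr_permE // stA.
by rewrite !(out_perm _ xA) ?restr_perm_on.
Qed.

(** A geodesic below c1 c2 preserves the cycles of c1 c2, hence A and B; its
    restrictions to A and B recover the two factors. *)
Lemma sum_geodesicM_disjoint (S : nmodType) A B c1 c2 (F : {perm T} -> S) :
  [disjoint A & B] -> perm_on A c1 -> perm_on B c2 ->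
  (\sum_(b | geodesic (c1 * c2) b) F b =
   \sum_(b1 | geodesic c1 b1) \sum_(b2 | geodesic c2 b2) F (b1 * b2)%g)%R.
Proof.
move=> dAB c1A c2B; rewrite pair_big /=.
rewrite (reindex_onto (fun p => p.1 * p.2)
                      (fun b => (restr_perm A b, restr_perm B b))) /=.
  apply: eq_bigl => -[b1 b2] /=; apply/andP/andP => [[g /eqP[E1 E2]]|[g1 g2]].
    apply/andP; rewrite -(geodesicM_disjoint dAB c1A c2B) //.
      by rewrite -E1 restr_perm_on.
    by rewrite -E2 restr_perm_on.
  have b1A := geodesic_on c1A g1; have b2B := geodesic_on c2B g2.
  rewrite (geodesicM_disjoint dAB) // g1 g2; split=> //.
  rewrite (restr_permM_disjoint dAB) // (perm_onC b1A b2B dAB).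
  by rewrite (@restr_permM_disjoint B A) // disjoint_sym.
move=> b gb; have bE := geodesic_fix gb.
have stab (C : {set T}) : (forall x, x \in C -> porbit (c1 * c2) x \subset C) ->
    b \in 'N(C | 'P).
  move=> sC; apply: astabs_perm => x xC; apply: (subsetP (sC x xC)).
  by apply: (subsetP (geodesic_porbit x gb)); rewrite perm_mem_porbit porbit_id.
have bA : b \in 'N(A | 'P).
  apply: stab => x; apply: porbit_sub => y yA; rewrite permM.
  rewrite (perm_on_notin c2B (_ : [disjoint B & A])) ?perm_closed //.
  by rewrite disjoint_sym.
have bB : b \in 'N(B | 'P).
  apply: stab => x; apply: porbit_sub => y yB; rewrite permM.
  by rewrite (perm_on_notin c1A dAB) // perm_closed.
have dBA : [disjoint B & A] by rewrite disjoint_sym.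
apply/permP => x; rewrite permM.
have [xA|xA] := boolP (x \in A).
  rewrite (restr_permE bA) // (perm_on_notin (restr_perm_on _ _) dBA) //.
  by rewrite -(restr_permE bA) // (perm_closed _ (restr_perm_on _ _)).
rewrite (out_perm (restr_perm_on _ _) xA).
have [xB|xB] := boolP (x \in B); first by rewrite restr_permE.
rewrite (out_perm (restr_perm_on _ _) xB) bE // permM.
by rewrite (out_perm c1A xA) (out_perm c2B xB).
Qed.
End PermLength.

Local Open Scope ring_scope.

(** * Geodesics below a cycle on an interval, and their recursion *)

Section Intervals.
Variable N : nat.
Implicit Types (a n p : nat) (i x : 'I_N.+1) (s c : 'S_N.+1).

Definition itv a n : {set 'I_N.+1} := [set i : 'I_N.+1 | a <= i < n]%N.

(** The cycle (a a+1 ... n-1), written as a product so that it is a permutation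
    for all a and n; the factor i = a is 1. *)
Definition itv_cycle a n : 'S_N.+1 :=
  (\prod_(a <= i < n) tperm (inord a) (inord i))%g.

Lemma itv_cycle_geq a n : (n <= a)%N -> itv_cycle a n = 1%g.
Proof. by move=> le; rewrite /itv_cycle big_geq. Qed.

Lemma itv_cycleS a n : (a <= n)%N ->
  itv_cycle a n.+1 = (itv_cycle a n * tperm (inord a) (inord n))%g.
Proof. by move=> le; rewrite /itv_cycle big_nat_recr. Qed.

Lemma tperm_inordE p n x : (p <= N)%N -> (n <= N)%N ->
  tperm (inord p) (inord n) x =
    (if x == p :> nat then n else if x == n :> nat then p else x) :> nat.
Proof.
move=> lep len; case: tpermP => [->|->|/eqP np /eqP nn].
- by rewrite !inordK ?eqxx.
- by rewrite !inordK ?eqxx //; case: eqP.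
move: np nn; rewrite -!val_eqE /= !inordK // => np nn.
by do 2 (case: ifP; first by lia).
Qed.

Lemma itv_cycleE a n x : (a <= n <= N.+1)%N ->
  itv_cycle a n x =
    (if a <= x < n then if x.+1 < n then x.+1 else a else x)%N :> nat.
Proof.
elim: n => [|n IH] /andP[lean lenN].
  by rewrite itv_cycle_geq ?perm1 ?andbF.
have [lan | ltna] := leqP a n; last first.
  by rewrite itv_cycle_geq ?perm1; try lia; case: ifP => //; lia.
rewrite itv_cycleS // permM tperm_inordE ?IH ?lan ?(ltnW lenN) //; last by lia.
by do ?[case: ifP => //=]; lia.
Qed.

Lemma itv_cycle_on a n :
  (a <= n <= N.+1)%N -> perm_on (itv a n) (itv_cycle a n).
Proof.
move=> le; apply/subsetP => x; rewrite !inE.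
apply: contraR => xI; apply/eqP/val_inj; rewrite /= itv_cycleE //.
by rewrite (negPf xI).
Qed.

Lemma itv_cycle_split a p n : (a <= p)%N -> (p < n)%N -> (n <= N)%N ->
  itv_cycle a n.+1 =
    (tperm (inord p) (inord n) * (itv_cycle a p.+1 * itv_cycle p.+1 n.+1))%g.
Proof.
move=> lap lpn lnN; apply/permP => x; rewrite !permM.
have ltx := ltn_ord x; apply: val_inj => /=.
rewrite !itv_cycleE ?tperm_inordE; try lia.
by do ?[case: ifP => //=]; lia.
Qed.

Lemma inordE n : (n <= N)%N -> (inord n : 'I_N.+1) = n :> nat.
Proof. by move=> le; rewrite inordK. Qed.

Lemma itv_disjoint a p n : [disjoint itv a p & itv p n].
Proof.
by rewrite disjoint_subset; apply/subsetP => x; rewrite !inE; lia.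
Qed.

Lemma itv_cycle_fix a n x :
  (a <= n <= N.+1)%N -> (n <= x)%N -> itv_cycle a n x = x.
Proof.
by move=> le lex; apply: out_perm (itv_cycle_on le) _; rewrite inE; lia.
Qed.

Lemma porbit_on (A : {set 'I_N.+1}) s x :
  perm_on A s -> x \in A -> porbit s x \subset A.
Proof. by move=> sA xA; apply: porbit_sub => // y yA; rewrite perm_closed. Qed.

Lemma geodesic_itv_cycle_last a n b : (a <= n <= N)%N ->
  geodesic (itv_cycle a n.+1) b && (b (inord n) == inord n) =
  geodesic (itv_cycle a n) b.
Proof.
case/andP=> lan lnN; rewrite itv_cycleS // geodesicM_tperm //.
by rewrite itv_cycle_fix ?inordE // lan ltnW.
Qed.

(** The permutations (p n) b with b fixing n are those that send p to n.  The
    factor (p n) cuts the cycle on [a, n] into cycles on [a, p] and [p + 1, n],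
    which lowers both lengths by 1; as b fixes n, the second cycle may then be
    shortened to [p + 1, n - 1]. *)
Lemma geodesic_itv_cycle_split a p n b :
  (a <= p)%N -> (p < n)%N -> (n <= N)%N ->
  geodesic (itv_cycle a n.+1) (tperm (inord p) (inord n) * b)%g
    && (b (inord n) == inord n)
  = geodesic (itv_cycle a p.+1 * itv_cycle p.+1 n)%g b.
Proof.
move=> lap lpn lnN; rewrite (itv_cycle_split lap lpn lnN); set t := tperm _ _.
have vn := inordE lnN.
have vp : (inord p : 'I_N.+1) = p :> nat by rewrite inordE; lia.
have pn : inord p != inord n :> 'I_N.+1 by rewrite -val_eqE /= vn vp; lia.
have aP : (a <= p.+1 <= N.+1)%N by lia.
have pN : (p.+1 <= n.+1 <= N.+1)%N by lia.
have E : itv_cycle a p.+1 (inord n) = inord n by rewrite (itv_cycle_fix aP) ?vn.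
have En : itv_cycle p.+1 n (inord n) = inord n.
  by rewrite itv_cycle_fix ?vn //; lia.
have cn : porbit (itv_cycle a p.+1 * itv_cycle p.+1 n.+1)%g (inord n)
          \subset itv p.+1 n.+1.
  apply: porbit_sub => [y yI|]; last by rewrite inE vn; lia.
  rewrite permM (itv_cycle_fix aP) ?(perm_closed _ (itv_cycle_on pN)) //.
  by move: yI; rewrite inE => /andP[].
have lt : plen (t * (itv_cycle a p.+1 * itv_cycle p.+1 n.+1))%g
          = (plen (itv_cycle a p.+1 * itv_cycle p.+1 n.+1)%g).+1.
  rewrite plen_tpermM // ifN //.
  by apply/negP => /(subsetP cn); rewrite inE vp; lia.
have -> : geodesic (t * (itv_cycle a p.+1 * itv_cycle p.+1 n.+1))%g (t * b)%g
      && (b (inord n) == inord n)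
  = geodesic (itv_cycle a p.+1 * itv_cycle p.+1 n.+1)%g b
      && (b (inord n) == inord n).
  rewrite andbC [RHS]andbC; case: eqP => //= bn.
  by rewrite geodesic_tpermM.
by rewrite (itv_cycleS lpn) mulgA geodesicM_tperm // permM E En.
Qed.

Lemma permV_eq s x y : ((s^-1)%g x == y) = (s y == x).
Proof. by rewrite -(inj_eq (@perm_inj _ s)) permKV eq_sym. Qed.

Section Weights.
Variables (S : comPzRingType) (G : nat -> S).

Definition orbit_top s x := [forall y in porbit s x, (y <= x)%N].

(** Each cycle is weighted at its greatest element, so that a product over
    cycles becomes a product over points, which splits along intervals. *)
Definition top_weight s x : S := if orbit_top s x then G #|porbit s x| else 1.

Definition itv_weight s a n : S := \prod_(a <= i < n) top_weight s (inord i).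

Definition geodesic_sum a n : S :=
  \sum_(b | geodesic (itv_cycle a n) b) itv_weight b a n.

(** The sum [geodesic_sum] with the cycle of the last point n - 1 counted as if
    it had j more points.  On the empty interval the value G j makes the
    recursion uniform: there it is the weight of a fixed point sitting just
    after the interval, with that point counted in the shift. *)
Definition shifted_sum j a n : S :=
  if (n <= a)%N then G j else
  \sum_(b | geodesic (itv_cycle a n) b)
     G (#|porbit b (inord n.-1)| + j)%N * itv_weight b a n.-1.

Lemma geodesic_sum_geq a n : (n <= a)%N -> geodesic_sum a n = 1.
Proof.
move=> le; rewrite /geodesic_sum itv_cycle_geq // (eq_bigl (pred1 1%g)) => [|b].
  by rewrite big_pred1_eq /itv_weight big_geq.
by rewrite geodesic1.
Qed.

Lemma geodesic_sumE a n : G 0 = 1 -> (a <= n <= N.+1)%N ->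
  geodesic_sum a n = shifted_sum 0 a n.
Proof.
move=> G0 le; rewrite /shifted_sum.
case: leqP => [lena|]; first by rewrite geodesic_sum_geq.
case: n le => // n le lan; apply: eq_bigr => b gb.
rewrite /itv_weight big_nat_recr //= mulrC addn0; congr (_ * _).
rewrite /top_weight ifT //; apply/forall_inP => y yb.
have: y \in itv a n.+1.
  apply: (subsetP (porbit_on (geodesic_on (itv_cycle_on le) gb) _)) yb.
  by rewrite inE inordE //; lia.
by rewrite inE inordE; lia.
Qed.

Lemma eq_top_weight s t x :
  porbit s x = porbit t x -> top_weight s x = top_weight t x.
Proof. by move=> E; rewrite /top_weight /orbit_top E. Qed.

Lemma top_weight1 s x y : y \in porbit s x -> (x < y)%N -> top_weight s x = 1.
Proof.
move=> ys xy; rewrite /top_weight ifN //; apply/forall_inPn.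
by exists y; rewrite // -ltnNge.
Qed.

(** The transposition (p n) attaches n to the cycle of p and leaves all other
    cycles alone.  The point p was the greatest of its cycle in [a, p] and no
    longer is in the merged one, which is why the first factor on the right
    stops before p. *)
Lemma itv_weight_merge a p n b1 b2 : (a <= p)%N -> (p < n)%N -> (n <= N)%N ->
  perm_on (itv a p.+1) b1 -> perm_on (itv p.+1 n) b2 ->
  let b := (tperm (inord p) (inord n) * (b1 * b2))%g in
  #|porbit b (inord n)| = #|porbit b1 (inord p)|.+1 /\
  itv_weight b a n = itv_weight b1 a p * itv_weight b2 p.+1 n.
Proof.
move=> lap lpn lnN b1A b2B b.
set P := inord p : 'I_N.+1; set Q := inord n : 'I_N.+1.
have vQ : Q = n :> nat by exact: inordE.
have vP : P = p :> nat by rewrite inordE; lia.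
set O1 := porbit b1 P.
have PA : P \in itv a p.+1 by rewrite inE vP; lia.
have O1A : O1 \subset itv a p.+1 by exact: porbit_on.
have QO1 : Q \notin O1 by apply/negP => /(subsetP O1A); rewrite inE vQ; lia.
have b1E x : x \in itv p.+1 n -> b1 x = x.
  by apply: perm_on_notin b1A (itv_disjoint _ _ _).
have b2E x : x \in itv a p.+1 -> b2 x = x.
  by apply: perm_on_notin b2B _; rewrite disjoint_sym itv_disjoint.
have b1Q : b1 Q = Q by rewrite (out_perm b1A) // inE vQ; lia.
have b2Q : b2 Q = Q by rewrite (out_perm b2B) // inE vQ; lia.
have bA x : x \in itv a p.+1 -> (b1 * b2)%g x = b1 x.
  by move=> xA; rewrite permM b2E // perm_closed.
have bQ : b Q = b1 P by rewrite permM tpermR bA.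
have bP : b P = Q by rewrite permM tpermL permM b1Q.
have bD x : x != P -> x != Q -> b x = (b1 * b2)%g x.
  by move=> xP xQ; rewrite [LHS]permM tpermD // eq_sym.
have CQ : porbit b Q = Q |: O1.
  have sub : porbit b Q \subset Q |: O1.
    apply: porbit_sub; last exact: setU11.
    move=> y; rewrite !inE => /orP[/eqP->|yO].
      by rewrite bQ perm_mem_porbit porbit_id orbT.
    have [->|yP] := eqVneq y P; first by rewrite bP eqxx.
    have yQ : y != Q by apply: contraNneq QO1 => <-.
    by rewrite bD // bA ?(subsetP O1A) // perm_mem_porbit yO orbT.
  have PC : P \in porbit b Q by rewrite -perm_mem_porbit bP porbit_id.
  apply/eqP; rewrite eqEsubset sub subUset sub1set porbit_id /=.
  apply: porbit_sub PC => y yC; have := subsetP sub _ yC.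
  rewrite !inE => /orP[/eqP->|yO]; first by rewrite b1Q porbit_id.
  have [->|yP] := eqVneq y P; first by rewrite -bQ perm_mem_porbit porbit_id.
  have yQ : y != Q by apply: contraNneq QO1 => <-.
  by rewrite -(bA y) ?(subsetP O1A) // -bD // perm_mem_porbit.
have bN x : x \notin Q |: O1 -> porbit b x = porbit (b1 * b2)%g x.
  move=> xN; apply: (@eq_in_porbit _ _ _ (~: (Q |: O1))); last by rewrite inE.
    move=> y; rewrite !inE negb_or => /andP[yQ yO]; apply: bD => //.
    by apply: contraNneq yO => ->; exact: porbit_id.
  by move=> y; rewrite !in_setC -CQ perm_mem_porbit.
have b1O x : x \in itv a p.+1 -> porbit (b1 * b2)%g x = porbit b1 x.
  move=> xA; apply/esym/(@eq_in_porbit _ _ _ (itv a p.+1)) => // y yA.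
    by rewrite bA.
  by rewrite perm_closed.
have b2O x : x \in itv p.+1 n -> porbit (b1 * b2)%g x = porbit b2 x.
  move=> xA; apply/esym/(@eq_in_porbit _ _ _ (itv p.+1 n)) => // y yA.
    by rewrite permM b1E.
  by rewrite perm_closed.
split; first by rewrite CQ cardsU1 QO1.
rewrite {1}/itv_weight (@big_cat_nat _ _ _ p.+1) //=; try lia.
rewrite big_nat_recr //= -/P (@top_weight1 b P Q) ?mulr1; last 2 first.
- by rewrite -eq_porbit_mem -(porbit_perm b 1 P) expg1 bP.
- by rewrite vP vQ.
congr (_ * _); apply: eq_big_nat => i /andP[lei lti].
  have vi : (inord i : 'I_N.+1) = i :> nat by rewrite inordE; lia.
  set x := inord i in vi *.
  have xA : x \in itv a p.+1 by rewrite inE vi; lia.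
  have [xO|xO] := boolP (x \in O1).
    rewrite (@top_weight1 b x Q); last by rewrite vi vQ; lia.
      rewrite (@top_weight1 b1 x P) //; last by rewrite vi vP.
      by rewrite porbit_sym.
    by rewrite porbit_sym CQ inE xO orbT.
  apply: eq_top_weight; rewrite bN ?b1O // !inE negb_or xO andbT.
  by rewrite -val_eqE /= vi vQ; lia.
have vi : (inord i : 'I_N.+1) = i :> nat by rewrite inordE; lia.
set x := inord i in vi *.
have xB : x \in itv p.+1 n by rewrite inE vi; lia.
apply: eq_top_weight; rewrite bN ?b2O // !inE negb_or.
rewrite -val_eqE /= vi vQ; apply/andP; split; first by lia.
by apply/negP => /(subsetP O1A); rewrite inE vi; lia.
Qed.

(** Sort the geodesics by the preimage q of the last point n.  The term p = a on
    the right is q = n, where n is a fixed point; the term p = q + 1 is q < n,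
    where q ends the left interval and its cycle takes over the extra point. *)
Lemma shifted_sumS j a n : (a <= n <= N)%N ->
  shifted_sum j a n.+1 =
    \sum_(a <= p < n.+1) shifted_sum j.+1 a p * geodesic_sum p n.
Proof.
case/andP=> lan lnN; rewrite {1}/shifted_sum leqNgt ltnS lan /=.
pose F b := G (#|porbit b (inord n)| + j)%N * itv_weight b a n.
transitivity (\sum_(a <= p < n.+1)
   \sum_(b | geodesic (itv_cycle a n.+1) b
             && ((b^-1)%g (inord n) == inord p)) F b).
  rewrite (partition_big (fun b : 'S_N.+1 => (b^-1)%g (inord n))
             (fun x => a <= x < n.+1)%N) /=; last first.
    move=> b gb; have leN : (a <= n.+1 <= N.+1)%N by lia.
    have := geodesic_on (itv_cycle_on leN) gb.
    move/perm_onV/(perm_closed (inord n)).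
    by rewrite !inE inordE // lan leqnn.
  rewrite big_geq_mkord /= (big_ord_widen_cond N.+1 (fun p => a <= p)%N
    (fun p => \sum_(b | geodesic (itv_cycle a n.+1) b
                        && ((b^-1)%g (inord n) == inord p)) F b)) //.
  by apply: eq_big => [x|x _] //; rewrite inord_val.
rewrite big_nat_recr //= addrC [RHS]big_ltn ?ltnS // big_add1 /=; congr (_ + _).
  rewrite /shifted_sum leqnn /geodesic_sum mulr_sumr; apply: eq_big => [b|b].
    by rewrite -(geodesic_itv_cycle_last b (_ : a <= n <= N)%N) ?lan // permV_eq.
  case/andP=> _ /eqP bn; rewrite /F porbit_fix ?cards1 //.
  by rewrite -{1}bn permKV.
apply: eq_big_nat => p /andP[lap lpn]; rewrite /shifted_sum leqNgt ltnS lap /=.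
rewrite (reindex_inj (mulgI (tperm (inord p) (inord n)))) /=.
rewrite (eq_bigl (geodesic (itv_cycle a p.+1 * itv_cycle p.+1 n)%g));
  last first.
  move=> b; rewrite -(geodesic_itv_cycle_split _ lap lpn lnN); congr (_ && _).
  by rewrite permV_eq permM tpermL.
have aP : (a <= p.+1 <= N.+1)%N by lia.
have pN : (p.+1 <= n <= N.+1)%N by lia.
rewrite (sum_geodesicM_disjoint _ (itv_disjoint a p.+1 n)
           (itv_cycle_on aP) (itv_cycle_on pN)).
rewrite mulr_suml; apply: eq_bigr => b1 g1; rewrite /geodesic_sum mulr_sumr.
apply: eq_bigr => b2 g2.
have [En Ew] := itv_weight_merge lap lpn lnN (geodesic_on (itv_cycle_on aP) g1)
                  (geodesic_on (itv_cycle_on pN) g2).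
by rewrite /F En Ew addnS mulrA.
Qed.

Lemma shifted_sum_conv j a n : G 0 = 1 -> (a + n <= N)%N ->
  shifted_sum j a (a + n.+1) =
    \sum_(i < n.+1) shifted_sum j.+1 a (a + i) * shifted_sum 0 (a + i) (a + n).
Proof.
move=> G0 le; rewrite addnS shifted_sumS ?leq_addr // -addnS.
rewrite -{1}[a]add0n big_addn addKn big_mkord; apply: eq_bigr => i _.
by rewrite addnC geodesic_sumE //; have := ltn_ord i; lia.
Qed.

Lemma orbit_top_inj s x y :
  orbit_top s x -> orbit_top s y -> porbit s x = porbit s y -> x = y.
Proof.
move=> /forall_inP tx /forall_inP ty E; apply/val_inj/eqP; rewrite /= eqn_leq.
apply/andP; split; [apply: ty; rewrite -E | apply: tx; rewrite E];
  exact: porbit_id.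
Qed.

Lemma prod_porbits s :
  \prod_(A in porbits s) G #|A| = itv_weight s 0 N.+1.
Proof.
rewrite /itv_weight big_mkord.
have -> : porbits s = porbit s @: [set x | orbit_top s x].
  apply/setP => A; apply/imsetP/imsetP => -[x _ ->]; last by exists x.
  have [z zx zmax] := arg_maxnP (@nat_of_ord _) (porbit_id s x).
  have Ez : porbit s z = porbit s x by apply/eqP; rewrite eq_porbit_mem.
  exists z; last by [].
  by rewrite inE; apply/forall_inP => i; rewrite Ez => /zmax.
rewrite big_imset /= => [|x y]; last by rewrite !inE; exact: orbit_top_inj.
rewrite big_mkcond /=; apply: eq_bigr => x _.
by rewrite inord_val inE.
Qed.
End Weights.

Lemma full_cycleE : full_cycle N.+1 = itv_cycle 0 N.+1.
Proof.
apply/permP => x; apply: val_inj.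
rewrite /= permE itv_cycleE ?ltn_ord //= /ordS /=.
have := ltn_ord x; rewrite ltnS leq_eqVlt => /orP[/eqP->|lt].
  by rewrite modnn ltnn.
by rewrite modn_small // ltnS lt.
Qed.
End Intervals.

Section NoncrossingNumbers.
Variables (S : comPzRingType) (G : nat -> S).
Hypothesis G0 : G 0 = 1.

(** The recursion sees only lengths of intervals, so neither the position of the
    interval nor the ambient symmetric group matters. *)
Lemma shifted_sum_translate n N N' a a' j :
  (a + n <= N.+1)%N -> (a' + n <= N'.+1)%N ->
  shifted_sum N G j a (a + n) = shifted_sum N' G j a' (a' + n).
Proof.
elim/ltn_ind: n N N' a a' j => -[|n] IH N N' a a' j.
  by rewrite !addn0 /shifted_sum !leqnn.
rewrite !addnS !ltnS => le le'; rewrite -!addnS !shifted_sum_conv //.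
apply: eq_bigr => -[i /= lti] _; congr (_ * _); first by apply: IH; lia.
have E b : (b + n = b + i + (n - i))%N by lia.
by rewrite (E a) (E a'); apply: IH; lia.
Qed.

(** The weighted count of noncrossing permutations of n points, as in
    [nc_numberE], with the cycle of the last point counted as if it had j more
    points. *)
Definition nc_number j n : S := shifted_sum n G j 0 n.

Lemma nc_number0 j : nc_number j 0 = G j.
Proof. by []. Qed.

Lemma nc_numberS j n :
  nc_number j n.+1 = \sum_(i < n.+1) nc_number j.+1 i * nc_number 0 (n - i).
Proof.
rewrite /nc_number -{2}[n.+1]add0n shifted_sum_conv //.
apply: eq_bigr => -[i /= lti] _.
have E k : k = (0 + k)%N by [].
congr (_ * _); first by rewrite {3}(E i); apply: shifted_sum_translate; lia.
rewrite {2}(E (n - i)%N) (_ : (0 + n = 0 + i + (n - i))%N); last by lia.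
by apply: shifted_sum_translate; lia.
Qed.

Lemma nc_numberE n : (0 < n)%N ->
  nc_number 0 n =
    \sum_(b | geodesic (full_cycle n) b) \prod_(A in porbits b) G #|A|.
Proof.
case: n => // n _; rewrite full_cycleE.
rewrite /nc_number (@shifted_sum_translate n.+1 n.+1 n 0 0 0) // add0n.
rewrite -geodesic_sumE ?leqnn //.
by apply: eq_bigr => b _; rewrite prod_porbits.
Qed.
End NoncrossingNumbers.

(** * Convolution with zeta at a full cycle *)

Section PartitionedPermutations.

Lemma porbits_partition (T : finType) (s : {perm T}) :
  partition (porbits s) [set: T].
Proof.
have -> : porbits s =
    equivalence_partition (fun x y => y \in porbit s x) [set: T].
  apply/setP => A; apply/imsetP/imsetP => -[x _ ->]; exists x => //.
    by apply/setP => y; rewrite !inE.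
  by apply/setP => y; rewrite !inE.
apply: equivalence_partitionP => x y z _ _ _; split; first exact: porbit_id.
by rewrite -!eq_porbit_mem => /eqP->.
Qed.

(** Sending a cycle to the block containing it is onto the blocks; it is
    injective only if every block is a single cycle. *)
Lemma refines_card (T : finType) (s : {perm T}) (P : {set {set T}}) :
  partition P [set: T] -> refines (porbits s) P ->
  (#|P| <= #|porbits s| ?= iff (P == porbits s))%N.
Proof.
move=> pP rP; have [/eqP cP tP P0] := and3P pP.
have xP x : x \in cover P by rewrite cP inE.
pose f (A : {set T}) := if [pick x in A] is Some x then pblock P x else set0.
have fE x : f (porbit s x) = pblock P x.
  rewrite /f; case: pickP => [y yx|/(_ x)]; last by rewrite porbit_id.
  apply/esym/same_pblock => //.
  have /forall_inP/(_ (porbit s x)) := rP.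
  move=> /(_ (imset_f _ isT))/exists_inP[B BP /subsetP sB].
  by rewrite (def_pblock tP BP (sB y yx)) sB ?porbit_id.
have PE : P = f @: porbits s.
  apply/setP => B; apply/idP/imsetP => [BP|[A /imsetP[x _ ->] ->]].
    have /set0Pn[x xB] : B != set0 by apply: contraNneq P0 => <-.
    exists (porbit s x); first exact: imset_f.
    by rewrite fE (def_pblock tP BP xB).
  by rewrite fE pblock_mem.
split; first by rewrite [in X in (X <= _)%N]PE leq_imset_card.
apply/idP/eqP => [|->] //; rewrite [in X in X == _]PE => /imset_injP inj.
rewrite PE -[RHS]imset_id; apply: eq_in_imset => _ /imsetP[x _ ->]; rewrite fE.
have mA y : porbit s y \in porbits s by exact: imset_f.
apply/setP => y; rewrite -eq_porbit_mem; apply/idP/eqP => [yx|E].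
  by apply: (inj _ _ (mA y) (mA x)); rewrite !fE (same_pblock tP yx).
by rewrite -fE -E fE mem_pblock.
Qed.

Section Cycle.
Variables (d : nat) (s : 'S_d) (x : 'I_d).
Let A := porbit s x.

Lemma iter_porbit_mem i : iter i s x \in A.
Proof. by rewrite -permX mem_porbit. Qed.

Lemma porbit_stable : s \in ('N(A | 'P))%g.
Proof. by apply: astabs_perm => y; rewrite /A perm_mem_porbit. Qed.

Definition cycle_rank (i : 'I_#|A|) : 'I_#|A| :=
  enum_rank_in (porbit_id s x) (iter i s x).

Lemma cycle_rankK i : enum_val (cycle_rank i) = iter i s x.
Proof. by rewrite enum_rankK_in // iter_porbit_mem. Qed.

Lemma cycle_rank_inj : injective cycle_rank.
Proof.
move=> i j /(congr1 enum_val); rewrite !cycle_rankK => E.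
apply/val_inj/eqP => /=.
rewrite -(nth_uniq x _ _ (uniq_traject_porbit s x)) ?size_traject //.
by rewrite !nth_traject // E.
Qed.

(** Numbering the cycle of x as x, s x, s (s x), and so on conjugates the
    restriction of s to the standard long cycle. *)
Lemma ps_restr_porbit : ps_restr A s \in (full_cycle #|A| ^: [set: 'S_#|A|])%g.
Proof.
suff -> : ps_restr A s = (full_cycle #|A| ^ perm cycle_rank_inj)%g.
  by rewrite memJ_class // inE.
apply/permP => i; rewrite -[i](permKV (perm cycle_rank_inj)) permJ.
move: ((perm cycle_rank_inj)^-1%g i) => {}i; rewrite ![in RHS]permE.
apply: enum_val_inj; rewrite permE /restr_fun cycle_rankK.
rewrite /ps_restr permE /restr_fun enum_rankK_in cycle_rankK.
  rewrite restr_permE ?porbit_stable ?iter_porbit_mem //.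
  rewrite -iterS /= ; have := ltn_ord i; rewrite leq_eqVlt => /orP[/eqP E|lt].
    by rewrite -[in LHS]iterS E modnn iter_porbit.
  by rewrite modn_small.
rewrite restr_permE ?porbit_stable ?iter_porbit_mem //.
by rewrite perm_mem_porbit iter_porbit_mem.
Qed.
End Cycle.

Lemma refines_refl (T : finType) (P : {set {set T}}) : refines P P.
Proof. by apply/forall_inP => A AP; apply/exists_inP; exists A. Qed.

Lemma ps_min_proof d (s : 'S_d) : is_partitioned_perm (porbits s, s).
Proof. by rewrite /is_partitioned_perm porbits_partition refines_refl. Qed.

(** (0_s, s), the partitioned permutation of least length over s, by [ps_lenP];
    [ps_zeta] is the indicator of these elements. *)
Definition ps_min d (s : 'S_d) : PS d := Sub (porbits s, s) (ps_min_proof s).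

(** The value 1 at 0 is the constant coefficient of the one-point series of
    order 0. *)
Definition cycle_values (S : comNzRingType) (g : PSfun S) (k : nat) : S :=
  if k is 0 then 1 else g k (ps_one (full_cycle k)).

Lemma ps_multiplicative_min (S : comNzRingType) (g : PSfun S) d (s : 'S_d) :
  ps_multiplicative g -> (0 < d)%N ->
  g d (ps_min s) = \prod_(A in porbits s) cycle_values g #|A|.
Proof.
move=> [gC gM] d0; rewrite gM //; apply: eq_bigr => _ /imsetP[x _ ->].
have c0 : (0 < #|porbit s x|)%N by apply/card_gt0P; exists x; exact: porbit_id.
rewrite -(gC _ _ _ c0 (ps_restr_porbit s x)) /cycle_values.
by case: #|_| c0.
Qed.

Lemma porbit_full_cycle d (x : 'I_d) : porbit (full_cycle d) x = [set: 'I_d].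
Proof.
case: d x => [[]//|d] x.
suff E y : y \in porbit (full_cycle d.+1) ord0.
  apply/setP => y; rewrite inE -eq_porbit_mem.
  have := E x; have := E y; rewrite -!eq_porbit_mem => /eqP-> /eqP->.
  by rewrite eqxx.
case: y => n; elim: n => [|n IH] lt.
  by rewrite (_ : Ordinal lt = ord0) ?porbit_id //; exact: val_inj.
rewrite (_ : Ordinal lt = full_cycle d.+1 (Ordinal (ltnW lt))).
  by rewrite perm_mem_porbit IH.
by apply: val_inj; rewrite /= permE /= modn_small.
Qed.

Lemma one_blockE d : (0 < d)%N -> one_block 'I_d = [set [set: 'I_d]].
Proof.
move=> d0; apply/setP => A; rewrite !inE andb_idl // => /eqP->.
by apply/set0Pn; exists (Ordinal d0); rewrite inE.
Qed.

Lemma porbits_full_cycle d :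
  (0 < d)%N -> porbits (full_cycle d) = one_block 'I_d.
Proof.
move=> d0; rewrite one_blockE //; apply/setP => A; rewrite inE.
apply/imsetP/eqP => [[x _ ->]|->]; first exact: porbit_full_cycle.
by exists (Ordinal d0); rewrite ?porbit_full_cycle.
Qed.

Lemma plenE d (s : 'S_d) : plen s = (d - #|porbits s|)%N.
Proof. by rewrite /plen card_ord. Qed.

Lemma ps_len_min d (s : 'S_d) : ps_len (ps_min s) = plen s.
Proof. by rewrite /ps_len /part_len /perm_len /= -plenE mul2n -addnn addnK. Qed.

Lemma ps_one_full_cycle d : (0 < d)%N ->
  ps_one (full_cycle d) = ps_min (full_cycle d).
Proof. by move=> d0; apply: val_inj; rewrite /= porbits_full_cycle. Qed.

Lemma ps_lenP d (x : PS d) :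
  (plen (ps_perm x) <= ps_len x ?= iff (x == ps_min (ps_perm x)))%N.
Proof.
case: x => -[P s] xP; have /andP[/= pP rP] := xP.
have [leP eqP] := refines_card pP rP.
have := porbits_leq s; rewrite card_ord => les.
rewrite /ps_len /part_len /perm_len /ps_part /ps_perm /= plenE.
rewrite -val_eqE /= xpair_eqE eqxx andbT.
move: #|P| #|porbits s| (P == _) leP eqP les => p o e lpo <- lod.
by split; lia.
Qed.

(** The block relations of the cycles of a and of b connect every point y to
    its image under b followed by a, hence connect everything when that product
    is a long cycle.  So the join condition of the convolution is automatic. *)
Lemma join_transitive d (a b : 'S_d) x : (0 < d)%N ->
  porbit (b * a)%g x = [set: 'I_d] ->
  join (porbits a) (porbits b) = one_block 'I_d.
Proof.
move=> d0 tr; rewrite /join; set e := fun _ _ => _.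
have pb (s : 'S_d) y : pblock (porbits s) y = porbit s y.
  have /and3P[_ tP _] := porbits_partition s.
  by apply: (def_pblock tP); rewrite ?porbit_id ?imset_f.
have es : symmetric e.
  by move=> y z; rewrite /e /same_block !pb ![z \in _]porbit_sym.
have cx y : connect e x y.
  have /porbitP[i ->] : y \in porbit (b * a)%g x by rewrite tr inE.
  elim: i => [|i IH]; first by rewrite expg0 perm1.
  rewrite expgSr permM permM; apply: connect_trans IH _.
  move: ((b * a) ^+ i)%g => c; apply: (@connect_trans _ _ (b (c x))).
    apply: connect1; rewrite /e /same_block !pb.
    by rewrite perm_mem_porbit porbit_id orbT.
  by apply: connect1; rewrite /e /same_block !pb perm_mem_porbit porbit_id.
have ct y z : connect e y z.
  by apply: connect_trans (cx z); rewrite (sym_connect_sym es).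
rewrite one_blockE //; apply/setP => A; rewrite inE.
have E y : [set z in [set: 'I_d] | connect e y z] = [set: 'I_d].
  by apply/setP => z; rewrite !inE ct.
apply/imsetP/eqP => [[y _ ->]|->]; first exact: E.
by exists x; rewrite ?E.
Qed.

(** Zeta selects the pairs ((0_a, a), (B, b)) with a = b^-1 c.  The length of
    (B, b) is at least |b|, and |a| + |b| >= |c|; the length condition turns
    both into equalities, leaving B = 0_b and b on a geodesic to c. *)
Lemma ps_conv_zeta_full_cycle (S : comNzRingType) (g : PSfun S) d :
  (0 < d)%N -> ps_multiplicative g ->
  ps_conv (@ps_zeta S) g (ps_one (full_cycle d)) =
  \sum_(b | geodesic (full_cycle d) b) \prod_(A in porbits b) cycle_values g #|A|.
Proof.
move=> d0 gM; rewrite ps_one_full_cycle // /ps_conv.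
set c := full_cycle d; rewrite pair_big_dep /=.
rewrite (bigID (fun p => ps_part p.1 == porbits (ps_perm p.1))) /=.
rewrite [X in _ + X]big1 ?addr0 => [|p /andP[_ /negPf Ep]]; last first.
  by rewrite /ps_zeta Ep mul0r.
rewrite (reindex_onto (fun b : 'S_d => (ps_min (b^-1 * c)%g, ps_min b))
                      (fun p : PS d * PS d => ps_perm p.2)) /=.
  apply: eq_big => [b|b _]; last first.
    by rewrite /ps_zeta /= eqxx mul1r ps_multiplicative_min.
  rewrite /ps_perm /ps_part /= !ps_len_min !eqxx !andbT mulKVg eqxx /=.
  rewrite (join_transitive (x := Ordinal d0)) //; last first.
    by rewrite mulKVg porbit_full_cycle.
  by rewrite porbits_full_cycle // eqxx /geodesic addnC.
move=> [x y] /= /andP[/and3P[_ /eqP Exy /eqP El] /eqP Ex].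
have xE : x = ps_min (ps_perm x) by apply: val_inj; rewrite /= -Ex; case: (x) => -[].
have Ec : (ps_perm y * ps_perm x)%g = c by [].
congr (_, _); first by rewrite [RHS]xE -Ec mulKg.
apply/esym/eqP; rewrite -(ps_lenP y) eqn_leq ps_lenP /=.
rewrite -(leq_add2l (plen (ps_perm x))) -[in X in (X + _)%N]ps_len_min -xE El.
by rewrite ps_len_min -Ec addnC plenM.
Qed.

End PartitionedPermutations.

(** * Power series: ring laws, substitution, logarithmic derivative *)

Section PowerSeries.
Variable R : comNzRingType.
Implicit Types f g h : fps R.

Definition fps_const (c : R) : fps R := fun n => if n is 0 then c else 0.
Definition fps_add f g : fps R := fun n => f n + g n.
Definition fps_opp f : fps R := fun n => - f n.

(** Truncations transfer the ring laws, the product rule and the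
    multiplicativity of substitution from polynomials to series, since a
    coefficient of degree at most N does not see the truncated terms. *)
Definition fps_trunc N f : {poly R} := \poly_(i < N.+1) f i.

Lemma coef_fps_trunc N f n : (n <= N)%N -> (fps_trunc N f)`_n = f n.
Proof. by move=> le; rewrite coef_poly ltnS le. Qed.

Lemma coefM_agree (p q : {poly R}) f g n :
  (forall m, (m <= n)%N -> p`_m = f m) ->
  (forall m, (m <= n)%N -> q`_m = g m) ->
  (p * q)`_n = fps_mul f g n.
Proof.
move=> pf qg; rewrite coefM; apply: eq_bigr => i _.
by rewrite pf ?qg ?leq_subr // -ltnS.
Qed.

Lemma coefM_fps_trunc N f g n : (n <= N)%N ->
  (fps_trunc N f * fps_trunc N g)`_n = fps_mul f g n.
Proof.
move=> le; apply: coefM_agree => m lem;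
  by rewrite coef_fps_trunc // (leq_trans lem).
Qed.

Lemma fps_mulC f g : fps_mul f g = fps_mul g f.
Proof.
apply: functional_extensionality => n.
by rewrite -!(coefM_fps_trunc _ _ (leqnn n)) mulrC.
Qed.

Lemma fps_mulA f g h : fps_mul f (fps_mul g h) = fps_mul (fps_mul f g) h.
Proof.
apply: functional_extensionality => n.
transitivity ((fps_trunc n f * (fps_trunc n g * fps_trunc n h))`_n).
  by apply/esym/coefM_agree => m le; rewrite ?coef_fps_trunc ?coefM_fps_trunc.
rewrite mulrA; apply: coefM_agree => m le;
  by rewrite ?coef_fps_trunc ?coefM_fps_trunc.
Qed.

Lemma fps_mul1 f : fps_mul (@fps_one R) f = f.
Proof.
apply: functional_extensionality => n.
rewrite /fps_mul big_ord_recl mul1r subn0.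
by rewrite big1 ?addr0 // => i _; rewrite /fps_one mul0r.
Qed.

Lemma fps_mulDl f g h :
  fps_mul (fps_add f g) h = fps_add (fps_mul f h) (fps_mul g h).
Proof.
apply: functional_extensionality => n; rewrite /fps_add /fps_mul -big_split.
by apply: eq_bigr => i _; rewrite mulrDl.
Qed.

Lemma fps_ring_theory : ring_theory (fps_const 0) (@fps_one R) fps_add
  (@fps_mul R) (@fps_sub R) fps_opp eq.
Proof.
split=> *; try apply: functional_extensionality => n.
- by rewrite /fps_add; case: n => [|n]; rewrite /= add0r.
- by rewrite /fps_add addrC.
- by rewrite /fps_add addrA.
- by rewrite fps_mul1.
- by rewrite fps_mulC.
- by rewrite fps_mulA.
- by rewrite fps_mulDl.
- by [].
- by case: n => [|n]; rewrite /fps_add /fps_opp subrr.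
Qed.
Add Ring fps_ring : fps_ring_theory.

Lemma fps_var_mul0 f : fps_mul (@fps_var R) f 0 = 0.
Proof. by rewrite /fps_mul big_ord_recl big_ord0 mul0r addr0. Qed.

Lemma fps_var_mulS f n : fps_mul (@fps_var R) f n.+1 = f n.
Proof.
rewrite /fps_mul big_ord_recl /= mul0r add0r big_ord_recl /= mul1r subSS subn0.
by rewrite big1 ?addr0 // => i _; rewrite /fps_var /= mul0r.
Qed.

Lemma fps_eq_const_var f c g : f 0 = c -> (forall n, f n.+1 = g n) ->
  f = fps_add (fps_const c) (fps_mul (@fps_var R) g).
Proof.
move=> f0 fS; apply: functional_extensionality => -[|n]; rewrite /fps_add.
  by rewrite fps_var_mul0 addr0.
by rewrite fps_var_mulS add0r.
Qed.

Lemma fps_exp_trunc N f k n : (n <= N)%N ->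
  (fps_trunc N f ^+ k)`_n = fps_exp f k n.
Proof.
elim: k n => [|k IH] n le; first by rewrite coef1.
rewrite exprS; apply: coefM_agree => m lem.
  by rewrite coef_fps_trunc // (leq_trans lem).
by rewrite IH // (leq_trans lem).
Qed.

(** Both sides are sums of p_i f^i; beyond i = n the powers of f do not reach
    degree n, and beyond the degree of p its coefficients vanish. *)
Lemma coef_comp_poly_agree (p : {poly R}) N g f n : f 0 = 0 -> (n <= N)%N ->
  (forall m, (m <= n)%N -> p`_m = g m) ->
  (p \Po fps_trunc N f)`_n = fps_comp g f n.
Proof.
move=> f0 le pg; rewrite comp_polyE coef_sum.
under eq_bigr => i _ do rewrite coefZ fps_exp_trunc //.
pose F i := p`_i * fps_exp f i n; pose K := maxn (size p) n.+1.
rewrite -[LHS]/(\sum_(i < size p) F i).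
rewrite (big_ord_widen K F) ?leq_maxl // big_mkcond /=.
transitivity (\sum_(i < K) F i).
  by apply: eq_bigr => i _; case: ltnP => // sp; rewrite /F nth_default ?mul0r.
rewrite /fps_comp (eq_bigr (fun i : 'I_n.+1 => F i)) => [|i _]; last first.
  by rewrite /F pg // -ltnS.
rewrite [RHS](big_ord_widen K F) ?leq_maxr // [RHS]big_mkcond /=.
apply: eq_bigr => i _; case: ltnP => // ni.
by rewrite /F fps_exp_eq0 ?mulr0.
Qed.

Lemma fps_comp_mul g h f : f 0 = 0 ->
  fps_comp (fps_mul g h) f = fps_mul (fps_comp g f) (fps_comp h f).
Proof.
move=> f0; apply: functional_extensionality => n.
rewrite -(@coef_comp_poly_agree (fps_trunc n g * fps_trunc n h) n) //;
  last first.
  by move=> m le; rewrite coefM_fps_trunc.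
rewrite comp_polyM; apply: coefM_agree => m le;
  apply: coef_comp_poly_agree => // k lek;
  by rewrite coef_fps_trunc // (leq_trans lek).
Qed.

Lemma fps_comp_add g h f :
  fps_comp (fps_add g h) f = fps_add (fps_comp g f) (fps_comp h f).
Proof.
apply: functional_extensionality => n; rewrite /fps_add /fps_comp -big_split.
by apply: eq_bigr => i _; rewrite mulrDl.
Qed.

Lemma fps_comp_const c f : fps_comp (fps_const c) f = fps_const c.
Proof.
apply: functional_extensionality => n; rewrite /fps_comp big_ord_recl /= big1.
  by case: n => [|n]; rewrite addr0 /fps_one /= ?mulr1 ?mulr0.
by move=> i _; rewrite mul0r.
Qed.

Lemma fps_comp_var f : f 0 = 0 -> fps_comp (@fps_var R) f = f.
Proof.
move=> f0; apply: functional_extensionality => -[|n].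
  by rewrite /fps_comp big_ord_recl big_ord0 /fps_var mul0r addr0 f0.
rewrite /fps_comp big_ord_recl /= mul0r add0r big_ord_recl /= mul1r big1 ?addr0.
  by rewrite fps_mulC fps_mul1.
by move=> i _; rewrite /fps_var /= mul0r.
Qed.

Lemma fps_derivM f g : fps_deriv (fps_mul f g) =
  fps_add (fps_mul (fps_deriv f) g) (fps_mul f (fps_deriv g)).
Proof.
apply: functional_extensionality => n.
rewrite /fps_deriv -(coefM_fps_trunc f g (leqnn n.+1)) -coef_deriv derivM coefD.
congr (_ + _); apply: coefM_agree => m le;
  by rewrite ?coef_deriv coef_fps_trunc // ?ltnS // ltnW.
Qed.

Lemma fps_mulVE f : f 0 = 1 -> fps_mul f (fps_inv f) = @fps_one R.
Proof. by move=> f0; apply: functional_extensionality; apply: fps_mulV. Qed.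

Lemma fps_inv0 f : fps_inv f 0 = 1.
Proof. by rewrite /fps_inv big_ord_recl big_ord0 addr0. Qed.

Lemma fps_invK f : f 0 = 1 -> fps_inv (fps_inv f) = f.
Proof.
move=> f0; have E := fps_mulVE f0; have E' := fps_mulVE (fps_inv0 f).
transitivity (fps_mul (fps_mul f (fps_inv f)) (fps_inv (fps_inv f))).
  by rewrite E; ring.
by rewrite -fps_mulA E'; ring.
Qed.

Lemma fps_deriv_var : fps_deriv (@fps_var R) = @fps_one R.
Proof.
by apply: functional_extensionality => -[|n] //; rewrite /fps_deriv mul0rn.
Qed.

Lemma fps_deriv_one : fps_deriv (@fps_one R) = fps_const 0.
Proof.
by apply: functional_extensionality => -[|n] //; rewrite /fps_deriv mul0rn.
Qed.

Lemma fps_dlog_var : fps_dlog (@fps_var R) = @fps_one R.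
Proof.
rewrite /fps_dlog fps_deriv_var fps_mul1.
have -> : fps_shift (@fps_var R) = @fps_one R by [].
by rewrite -[LHS]fps_mul1 fps_mulVE.
Qed.

(** From ln X = ln w - ln g comes dln X / dln w = 1 - w g' / g = 1 - X g'. *)
Lemma fps_dlog_div_var g : g 0 = 1 ->
  let X := fps_mul (@fps_var R) (fps_inv g) in
  fps_dlog X = fps_sub (@fps_one R) (fps_mul X (fps_deriv g)).
Proof.
move=> g0 X; rewrite /fps_dlog.
have -> : fps_shift X = fps_inv g.
  by apply: functional_extensionality => n; rewrite /fps_shift /X fps_var_mulS.
have E := fps_mulVE g0.
have dE : fps_add (fps_mul (fps_deriv g) (fps_inv g))
                  (fps_mul g (fps_deriv (fps_inv g))) = fps_const 0.
  by rewrite -fps_derivM E fps_deriv_one.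
rewrite fps_invK // fps_derivM fps_deriv_var.
transitivity (fps_add
  (fps_sub (fps_mul g (fps_inv g)) (fps_mul X (fps_deriv g)))
  (fps_mul (@fps_var R) (fps_add (fps_mul (fps_deriv g) (fps_inv g))
                  (fps_mul g (fps_deriv (fps_inv g)))))).
  by rewrite /X; ring.
by rewrite dE E; ring.
Qed.

Lemma eq_fps_mul f f' g g' n : (forall m, (m <= n)%N -> f m = f' m) ->
  (forall m, (m <= n)%N -> g m = g' m) -> fps_mul f g n = fps_mul f' g' n.
Proof.
by move=> ef eg; apply: eq_bigr => i _; rewrite ef ?eg ?leq_subr // -ltnS.
Qed.

(** The engine of the uniqueness arguments: in an equation a = c + X F(a) the
    coefficients of a of degree below n determine that of degree n. *)
Lemma eq_fps_mul_lt X g g' n : X 0 = 0 -> (forall m, (m < n)%N -> g m = g' m) ->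
  fps_mul X g n = fps_mul X g' n.
Proof.
move=> X0 eg; rewrite /fps_mul !big_ord_recl X0 !mul0r; congr (_ + _).
by apply: eq_bigr => i _; rewrite eg //= /bump; have := ltn_ord i; lia.
Qed.

Section Substitution.
Variables (g g' : fps R) (v v' : nat -> fps R).
(* vE and v'E are the coefficients of 1 and of h in the equations
   V_j = G_j + w V_(j+1) V_0 over the dual numbers, where G = g + h g'. *)
Hypothesis g0 : g 0 = 1.
Local Notation w := (@fps_var R).
Hypothesis vE : forall j, 
  v j = fps_add (fps_const (g j)) (fps_mul w (fps_mul (v j.+1) (v 0))).
Hypothesis v'E : forall j, 
  v' j = fps_add (fps_const (g' j))
    (fps_mul w (fps_add (fps_mul (v' j.+1) (v 0)) (fps_mul (v j.+1) (v' 0)))).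

Let X := fps_mul w (fps_inv g).
Let tail (h : fps R) j : fps R := fun n => h (n + j)%N.

Let X0 : X 0 = 0. Proof. exact: fps_var_mul0. Qed.

Let XgE : fps_mul X g = w.
Proof.
by rewrite /X -fps_mulA (fps_mulC _ g) fps_mulVE // fps_mulC fps_mul1.
Qed.

Let tailE h j : tail h j = fps_add (fps_const (h j)) (fps_mul w (tail h j.+1)).
Proof. by apply: fps_eq_const_var => [|n]; rewrite /tail ?addSnnS. Qed.

Let tail0 h : tail h 0 = h.
Proof. by apply: functional_extensionality => n; rewrite /tail addn0. Qed.

(** At X, both families solve a_j = g_j + X a_(j+1) a_0. *)
Lemma comp_leading j : fps_comp (v j) X = tail g j.
Proof.
suff agree n : forall j, fps_comp (v j) X n = tail g j n.
  by apply: functional_extensionality => n; apply: agree.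
elim/ltn_ind: n => n IH {}j.
rewrite {1}vE fps_comp_add fps_comp_const !fps_comp_mul // fps_comp_var //.
rewrite [tail g j]tailE -XgE -fps_mulA /fps_add; congr (_ + _).
apply: eq_fps_mul_lt => // m ltm; rewrite fps_mulC.
by apply: eq_fps_mul => k lek; rewrite IH ?tail0 // (leq_ltn_trans lek).
Qed.

(** The series sum_s w^s tail_(s + j + 1)(g), which collects the contributions
    of X b_0 tail_(j+1)(g) when the linear equations are iterated; for j = 0 it
    is the derivative of g. *)
Let tail_sum j : fps R := fun n => g (n + j).+1 *+ n.+1.

Let tail_sumE j :
  tail_sum j = fps_add (tail g j.+1) (fps_mul w (tail_sum j.+1)).
Proof.
apply: functional_extensionality => -[|n]; rewrite /fps_add.
  by rewrite fps_var_mul0 addr0 /tail_sum /tail.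
by rewrite fps_var_mulS /tail_sum /tail !addnS addSn mulrS.
Qed.

(** At X, both families solve b_j = g'_j + X b_0 tail_(j+1)(g) + w b_(j+1), a
    linear system once the series b_0 = v'_0(X) is given. *)
Lemma comp_correction j :
  fps_comp (v' j) X =
    fps_add (tail g' j) (fps_mul (fps_mul X (fps_comp (v' 0) X)) (tail_sum j)).
Proof.
set b0 := fps_comp (v' 0) X.
suff H n : forall j, fps_comp (v' j) X n =
   fps_add (tail g' j) (fps_mul (fps_mul X b0) (tail_sum j)) n.
  by apply: functional_extensionality => n; apply: H.
elim/ltn_ind: n => n IH {}j.
rewrite v'E !(fps_comp_add, fps_comp_const, fps_comp_mul, fps_comp_var) //.
rewrite -/b0 !comp_leading tail0.
have -> : fps_add (tail g' j) (fps_mul (fps_mul X b0) (tail_sum j)) =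
  fps_add (fps_add (fps_const (g' j)) (fps_mul (fps_mul X b0) (tail g j.+1)))
   (fps_mul w (fps_add (tail g' j.+1)
                       (fps_mul (fps_mul X b0) (tail_sum j.+1)))).
  by rewrite tailE tail_sumE; ring.
have -> : fps_add (fps_const (g' j)) (fps_mul X
    (fps_add (fps_mul (fps_comp (v' j.+1) X) g) (fps_mul (tail g j.+1) b0))) =
  fps_add (fps_add (fps_const (g' j)) (fps_mul (fps_mul X b0) (tail g j.+1)))
   (fps_mul w (fps_comp (v' j.+1) X)).
  by rewrite -XgE; ring.
rewrite /fps_add -/fps_add; congr (_ + _); apply: eq_fps_mul_lt => // m ltm.
exact: IH.
Qed.

Lemma substitution_dlog :
  fps_mul (fps_comp (v' 0) X) (fps_dlog X) = g'.
Proof.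
rewrite (fps_dlog_div_var g0) -/X.
set b0 := fps_comp _ _.
have tail_sum0 : tail_sum 0 = fps_deriv g.
  by apply: functional_extensionality => n; rewrite /tail_sum addn0.
transitivity (fps_sub b0 (fps_mul (fps_mul X b0) (fps_deriv g))); first by ring.
by rewrite {1}/b0 comp_correction tail0 tail_sum0 -/b0; ring.
Qed.

Lemma substitution_main :
  fps_comp (v' 0) X = fps_mul (fps_mul (fps_dlog w) (fps_inv (fps_dlog X))) g'.
Proof.
have d0 : fps_dlog X 0 = 1.
  rewrite (fps_dlog_div_var g0) /fps_sub -/X /fps_mul big_ord_recl big_ord0.
  by rewrite X0 mul0r !addr0 subr0.
rewrite -substitution_dlog fps_dlog_var.
transitivity (fps_mul (fps_comp (v' 0) X)
                      (fps_mul (fps_dlog X) (fps_inv (fps_dlog X)))).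
  by rewrite fps_mulVE //; ring.
by ring.
Qed.
End Substitution.
End PowerSeries.

(** * Coefficients of dual numbers *)

Section DualNumbers.
Variable R : comNzRingType.

Definition dual_coef (k : nat) (x : dual R) : R := (x : {poly R})`_k.

Lemma dual_coef_sum k I (r : seq I) (P : pred I) (F : I -> dual R) :
  dual_coef k (\sum_(i <- r | P i) F i) = \sum_(i <- r | P i) dual_coef k (F i).
Proof. by rewrite /dual_coef poly_of_qpoly_sum coef_sum. Qed.

Lemma dual_coefM k (x y : dual R) : (k < 2)%N ->
  dual_coef k (x * y) = ((x : {poly R}) * (y : {poly R}))`_k.
Proof.
move=> ltk; rewrite /dual_coef poly_of_qpolyM; move: (_ * _ : {poly R}) => p.
by rewrite mk_monic_Xn -Pdiv.RingMonic.take_poly_rmodp coef_take_poly ltk.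
Qed.

Lemma dual_coef0M x y : dual_coef 0 (x * y) = dual_coef 0 x * dual_coef 0 y.
Proof. by rewrite dual_coefM // coefM big_ord_recl big_ord0 addr0. Qed.

Lemma dual_coef1M x y :
  dual_coef 1 (x * y) =
    dual_coef 1 x * dual_coef 0 y + dual_coef 0 x * dual_coef 1 y.
Proof. by rewrite dual_coefM // coefM !big_ord_recl big_ord0 addr0 addrC. Qed.

Lemma dual_coef_one k : dual_coef k 1 = (k == 0)%:R.
Proof. by rewrite /dual_coef /= coef1. Qed.

Lemma dual_coef_flat (f f' : PSfun R) d (x : PS d) k : (k < 2)%N ->
  dual_coef k (flat f f' x) = if k == 0 then f d x else f' d x.
Proof.
move=> ltk; rewrite /dual_coef /flat poly_of_qpolyD coefD.
rewrite -[(_ *: hbar R : dual R) : {poly R}]/(f' d x *: (hbar R : {poly R})).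
rewrite -[(_%:A : dual R) : {poly R}]/(f d x *: (1 : {poly R})).
rewrite /hbar in_qpoly_small; last first.
  by rewrite mk_monic_Xn size_polyX size_polyXn.
rewrite !coefZ coef1 coefX.
by case: k ltk => [|[|]] //= _; rewrite ?mulr1 ?mulr0 ?addr0 ?add0r.
Qed.
End DualNumbers.

Theorem corollary5p16 (R : comAlgType rat) (phi phi' phiv phiv' : PSfun R) :
  ps_multiplicative (flat phi phi') ->
  ps_multiplicative (flat phiv phiv') ->
  (forall d (x : PS d), (0 < d)%N ->
     flat phi phi' x = ps_conv (@ps_zeta (dual R)) (flat phiv phiv') x) ->
  let w : fps R := @fps_var R in
  let Gv01 : fps R := one_point 1 phiv in
  let G12 : fps R := one_point 0 phi' in
  let Gv12 : fps R := one_point 0 phiv' in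
  let X : fps R := fps_mul w (fps_inv Gv01) in
  (* dln w / dln X *)
  let Pv : fps R := fps_mul (fps_dlog w) (fps_inv (fps_dlog X)) in
  fps_comp G12 X =1 fps_mul Pv Gv12 /\
  (* G12(X) dX / X = Gv12(w) dw / w *)
  fps_mul (fps_comp G12 X) (fps_dlog X) =1 fps_mul Gv12 (fps_dlog w).
Proof.
move=> _ gM fE w Gv01 G12 Gv12 X Pv.
pose G := cycle_values (flat phiv phiv').
pose v j : fps R := fun n => dual_coef 0 (nc_number G j n).
pose v' j : fps R := fun n => dual_coef 1 (nc_number G j n).
have G0 : G 0 = 1 by [].
have fncE n : (0 < n)%N ->
    flat phi phi' (ps_one (full_cycle n)) = nc_number G 0 n.
  by move=> n0; rewrite fE // ps_conv_zeta_full_cycle // nc_numberE.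
have gE n : dual_coef 0 (G n) = Gv01 n.
  by case: n => [|n]; rewrite /G ?dual_coef_one // dual_coef_flat.
have g'E n : dual_coef 1 (G n) = Gv12 n.
  by case: n => [|n]; rewrite /G ?dual_coef_one // dual_coef_flat.
have G12E : G12 = v' 0.
  apply: functional_extensionality => -[|n].
    by rewrite /v' nc_number0 g'E.
  by rewrite /v' -fncE // dual_coef_flat.
have vE j : v j = fps_add (fps_const (Gv01 j))
    (fps_mul w (fps_mul (v j.+1) (v 0))).
  apply: fps_eq_const_var => [|n]; first by rewrite /v nc_number0 gE.
  rewrite /v nc_numberS // dual_coef_sum; apply: eq_bigr => i _.
  exact: dual_coef0M.
have v'E j : v' j = fps_add (fps_const (Gv12 j))
    (fps_mul w (fps_add (fps_mul (v' j.+1) (v 0)) (fps_mul (v j.+1) (v' 0)))).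
  apply: fps_eq_const_var => [|n]; first by rewrite /v' nc_number0 g'E.
  rewrite /v' nc_numberS // dual_coef_sum /fps_add /fps_mul -big_split.
  by apply: eq_bigr => i _; exact: dual_coef1M.
have Gv0 : Gv01 0 = 1 by [].
rewrite G12E; split=> n; first by rewrite (substitution_main Gv0 vE v'E).
by rewrite (substitution_dlog Gv0 vE v'E) fps_dlog_var fps_mulC fps_mul1.
Qed.
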